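(* Let $E$ be a finite set, $\mathcal{P}\subseteq 2^E$, $\pi \in [0,1]^{\mathcal{P}}$, and $\rho\in[0,1]^E$ with $\sum_{e \in P}\rho_e \ge \pi_P$ for all $P\in\mathcal{P}$. Let $S_\rho \subseteq E$ be the random set containing each $e\in E$ independently with probability $\rho_e$, and let $x_S := \Pr[S_\rho = S]$ for $S \subseteq E$. Then $x$ is a $(1 - 1/\mathrm{e})$-approximately feasible decomposition of $\rho$ for $(E,\mathcal{P},\pi)$.
   Context: For $\beta\in[0,1]$, a $\beta$-approximately feasible decomposition of $\rho$ for $(E,\mathcal{P},\pi)$ is a vector $x\in\mathbb{R}^{2^E}$ with $x_S \ge 0$ for all $S \subseteq E$, $\sum_{S} x_S = 1$, $\sum_{S : e \in S} x_S = \rho_e$ for all $e\in E$, and $\sum_{S : S\cap P\neq\emptyset} x_S \ge \beta\cdot\pi_P$ for all $P\in\mathcal{P}$. Here $\mathrm{e}$ is Euler's number. *)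

(* Defs.v *)
From mathcomp Require Import all_boot all_order all_algebra.
From mathcomp Require Import all_classical all_reals all_analysis.

Set Implicit Arguments.
Unset Strict Implicit.
Unset Printing Implicit Defensive.

Import Order.TTheory GRing.Theory Num.Theory.

Local Open Scope classical_set_scope.
Local Open Scope ring_scope.

(* The set system is [calP]; [req P] is the requirement pi_P, which is only
   meaningful for [P \in calP].  [finset.set0] is the empty [{set E}], as
   opposed to the empty classical set. *)
Record approx_feasible_decomposition (R : realType) (E : finType)
    (calP : {set {set E}}) (req : {set E} -> R) (rho : E -> R)
    (beta : R) (x : {set E} -> R) : Prop := ApproxFeasibleDecomposition {
  afd_ge0 : forall S : {set E}, 0 <= x S ;
  afd_sum1 : \sum_(S : {set E}) x S = 1 ;
  afd_marginal : forall e : E, \sum_(S : {set E} | e \in S) x S = rho e ;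
  afd_hit : forall P : {set E}, P \in calP ->
    \sum_(S : {set E} | S :&: P != finset.set0) x S >= beta * req P
}.

(* The product rule is required for every subfamily, not just pairs. *)
Definition mutually_independent_events (d : measure_display)
    (T : measurableType d) (R : realType) (Pr : probability T R)
    (I : finType) (A : I -> set T) : Prop :=
  (forall i, measurable (A i)) /\
  forall J : {set I},
    Pr (\bigcap_(i in [set` J]) A i) = (\prod_(i in J) Pr (A i))%E.

(* A {set E}-valued map Srho on an arbitrary probability space such that the
   events {e \in Srho} are mutually independent with probabilities rho e. *)
Definition independent_random_set (d : measure_display)
    (T : measurableType d) (R : realType) (Pr : probability T R)
    (E : finType) (rho : E -> R) (Srho : T -> {set E}) : Prop :=
  mutually_independent_events Pr (fun e : E => [set w | e \in Srho w]) /\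
  forall e : E, Pr [set w | e \in Srho w] = (rho e)%:E.

Definition random_set_law (d : measure_display)
    (T : measurableType d) (R : realType) (Pr : probability T R)
    (E : finType) (Srho : T -> {set E}) : {set E} -> R :=
  fun S => fine (Pr [set w | Srho w = S]).

(* Main.v *)
Require Import Defs.
From mathcomp Require Import all_boot all_order all_algebra.
From mathcomp Require Import all_classical all_reals all_analysis.
From mathcomp Require Import lra.

Import Order.TTheory GRing.Theory Num.Theory.
Local Open Scope ring_scope.

(** Independence gives [Pr (S_rho `&` P = set0) = \prod_(e in P) (1 - rho e)],
    which is at most [expR (- \sum_(e in P) rho e) <= expR (- req P)].
    Convexity of [expR] on [[-1, 0]] bounds [expR (- t)] by the chord
    [1 - (1 - expR (-1)) * t], so [P] is hit with probability at least
    [(1 - 1 / expR 1) * req P]. *)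

(* Inclusion-exclusion: the weights of the up-sets of [x] determine those of
   the sets avoiding [s]; carrying [J] along makes the induction on [s] work. *)
Lemma sum_superset_avoiding {R : comPzRingType} {E : finType}
    (x : {set E} -> R) (p : E -> R) (s : seq E) (J : {set E}) :
  (forall K : {set E},
    \sum_(S : {set E} | K \subset S) x S = \prod_(e in K) p e) ->
  uniq s -> {in s, forall e, e \notin J} ->
  \sum_(S : {set E} | (J \subset S) && all [pred e | e \notin S] s) x S =
  \prod_(e in J) p e * \prod_(e <- s) (1 - p e).
Proof.
move=> xE; elim: s J => [|k s IHs] J /=.
  move=> _ _; rewrite big_nil mulr1 -xE.
  by apply: eq_bigl => S; rewrite andbT.
move=> /andP[ks us] sJ.
have kJ : k \notin J by apply: sJ; rewrite mem_head.
have sJ' : {in s, forall e, e \notin J}.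
  by move=> e es; apply: sJ; rewrite inE es orbT.
have skJ : {in s, forall e, e \notin k |: J}.
  move=> e es; rewrite in_setU1 negb_or sJ' // andbT.
  by apply: contraNneq ks => <-.
(* The hypothesis for [J] is split by whether [k] lies in [S]: the part with [k] is the hypothesis
   for [k |: J], and the part without [k] is the sum sought, obtained by subtraction. *)
have := IHs J us sJ'; rewrite (bigID (fun S : {set E} => k \in S)) /=.
have -> : \sum_(S : {set E} | (J \subset S) && all [pred e | e \notin S] s
    && (k \in S)) x S = p k * \prod_(e in J) p e * \prod_(e <- s) (1 - p e).
  rewrite -(big_setU1 _ kJ) /= -(IHs _ us skJ); apply: eq_bigl => S.
  by rewrite finset.subUset finset.sub1set; case: (k \in S); rewrite ?andbF ?andbT.
rewrite (eq_bigl (fun S : {set E} =>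
  (J \subset S) && ((k \notin S) && all [pred e | e \notin S] s))); last first.
  by move=> S; rewrite -andbA (andbC (all _ _)).
move=> /(canRL (addKr _)) ->.
by rewrite big_cons mulrBl mul1r mulrBr mulrCA -mulrA addrC.
Qed.

(** Inclusion-exclusion with [J] empty and [s] the enumeration of [P]: avoiding every element of
    [enum P] is being disjoint from [P]. *)
Lemma sum_disjoint_prod {R : comPzRingType} {E : finType}
    (x : {set E} -> R) (p : E -> R) (P : {set E}) :
  (forall K : {set E},
    \sum_(S : {set E} | K \subset S) x S = \prod_(e in K) p e) ->
  \sum_(S : {set E} | S :&: P == finset.set0) x S = \prod_(e in P) (1 - p e).
Proof.
move=> xE; have s0 : {in enum P, forall e, e \notin (finset.set0 : {set E})}.
  by move=> e _; rewrite finset.in_set0.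
have := sum_superset_avoiding x p _ _ xE (enum_uniq P) s0.
rewrite finset.big_set0 mul1r big_enum /= => <-.
apply: eq_bigl => S; rewrite finset.sub0set /= setI_eq0 disjoint_sym disjoint_subset.
apply/fintype.subsetP/allP => [SP e|SP e eP].
  by rewrite mem_enum => /SP; rewrite inE.
by rewrite inE; apply: SP; rewrite mem_enum.
Qed.

(** Factor by factor, [1 - p e <= expR (- p e)]; the bound [p e <= 1] keeps the factors nonnegative,
    so that the inequalities multiply. *)
Lemma prod_1B_le_expR_sum {R : realType} {E : finType} (P : {set E})
    (p : E -> R) :
  (forall e, p e <= 1) ->
  \prod_(e in P) (1 - p e) <= expR (- \sum_(e in P) p e).
Proof.
move=> p1; rewrite -sumrN expR_sum; apply: ler_prod => e _.
by rewrite subr_ge0 p1 /= expR_ge1Dx.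
Qed.

Lemma expRN_le_chord {R : realType} (t : R) :
  0 <= t <= 1 -> expR (- t) <= 1 - (1 - 1 / expR 1) * t.
Proof.
move=> /andP[t0 t1].
(* [- t] is the convex combination of [-1] and [0] with weight [t] on [-1]. *)
have := convex_expR (Itv01 t0 t1) (- 1 : R^o) (0 : R^o).
rewrite !convRE /= mulr0 addr0 mulrN1 expR0 mulr1 /unstable.onem.
move=> /le_trans; apply.
by rewrite (expRN 1) div1r mulrBl mul1r opprB addrCA mulrC.
Qed.

Section RandomSet.
Context {d : measure_display} {T : measurableType d} {R : realType}.
Context (Pr : probability T R) {E : finType} (X : T -> {set E}).
Hypothesis mX : forall e, measurable [set w | e \in X w]%classic.

(** Equality with [S] is decided element by element, so the event is a finite intersection of
    membership events and complements of such events. *)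
Lemma random_set_measurable_eq (S : {set E}) :
  measurable [set w | X w = S]%classic.
Proof.
have -> : [set w | X w = S]%classic = (\bigcap_(e in [set: E])
    if e \in S then [set w | e \in X w] else ~` [set w | e \in X w])%classic.
  apply/seteqP; split=> [w /= XS e _|w /= XS].
    by rewrite -XS; case: ifPn => //= /negP.
  apply/finset.setP => e; have := XS e I.
  by case: ifPn => [_ /= ->|_ /= /negP/negbTE].
apply: fin_bigcap_measurable => [|e _]; first exact: finite_finset.
by case: ifP => _; [exact: mX|exact/measurableC/mX].
Qed.

(** Finite additivity: the event on the right is the disjoint union of the fibres of [X] over the
    sets satisfying [Q]. *)
Lemma sum_random_set_law (Q : pred {set E}) :
  \sum_(S | Q S) random_set_law Pr X S = fine (Pr [set w | Q (X w)]%classic).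
Proof.
have mS S : measurable [set w | X w = S]%classic.
  exact: random_set_measurable_eq.
rewrite /random_set_law sum_fine; last by move=> S _; exact: fin_num_measure.
congr fine; rewrite bigfs ?index_enum_uniq //; last first.
  by move=> S _; rewrite mem_index_enum.
rewrite -measure_fin_bigcup //; last first.
  by move=> S S' _ _ [w [/= <- <-]].
congr (Pr _); apply/seteqP; split=> [w [S QS XS]|w QX]; last by exists (X w).
by rewrite /= XS.
Qed.

End RandomSet.

Theorem theorem9 (R : realType) (E : finType) (calP : {set {set E}})
    (req : {set E} -> R) (rho : E -> R)
    (hreq : forall P : {set E}, P \in calP -> 0 <= req P <= 1)
    (hrho : forall e : E, 0 <= rho e <= 1)
    (hcover : forall P : {set E}, P \in calP ->
      \sum_(e in P) rho e >= req P)
    (d : measure_display) (T : measurableType d) (Pr : probability T R)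
    (Srho : T -> {set E}) (hS : independent_random_set Pr rho Srho) :
  approx_feasible_decomposition calP req rho (1 - 1 / expR 1)
    (random_set_law Pr Srho).
Proof.
case: hS => -[mS indep] marg.
have sum1 : \sum_S random_set_law Pr Srho S = 1.
  rewrite (sum_random_set_law Pr Srho mS xpredT).
  have -> : [set w | xpredT (Srho w)]%classic = [set: T]%classic.
    by apply/seteqP; split.
  by rewrite probability_setT.
split=> //.
- by move=> S; apply: fine_ge0; exact: measure_ge0.
- by move=> e; rewrite (sum_random_set_law Pr Srho mS (fun S => e \in S)) marg.
move=> P PP.
(* Independence enters here: [K \subset Srho w] is the joint occurrence of the membership events for
   [e] in [K]. *)
have supE (K : {set E}) : \sum_(S : {set E} | K \subset S)
    random_set_law Pr Srho S = \prod_(e in K) rho e.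
  rewrite (sum_random_set_law Pr Srho mS (fun S => K \subset S)).
  have -> : [set w | K \subset Srho w]%classic =
      (\bigcap_(e in [set` K]) [set w | e \in Srho w])%classic.
    apply/seteqP; split=> [w /= /fintype.subsetP KS e|w KS]; first exact: KS.
    by apply/fintype.subsetP => e eK; exact: KS.
  by rewrite indep (eq_bigr _ (fun e _ => marg e)) prodEFin.
(* Passing to the complement turns the probability of hitting [P] into
   [1 - \prod_(e in P) (1 - rho e)]. *)
have := sum1; rewrite (bigID (fun S : {set E} => S :&: P == finset.set0)) /=.
rewrite (sum_disjoint_prod _ _ _ supE) => /(canRL (addKr _)) ->.
have rho1 e : rho e <= 1 by case/andP: (hrho e).
have := prod_1B_le_expR_sum P _ rho1.
have := expRN_le_chord _ (hreq _ PP).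
have : expR (- \sum_(e in P) rho e) <= expR (- req P).
  by rewrite ler_expR lerN2 hcover.
lra.
Qed.
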